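(* Let $\Gamma$ be a digraph with vertex set $V=\{1,\dots,n\}$, $n>1$. For $i,j\in V$ let $f_{ij}$ be the total weight of all in-forests of $\Gamma$ in which vertex $i$ belongs to a tree rooted at $j$. Then the matrix of in-forests $F=(f_{ij})$ determines a transitional measure for $\Gamma$.
   Context: A digraph $\Gamma$ here is a weighted directed multigraph without loops, with vertex set $\{1,\dots,n\}$; each arc has a positive weight. The weight of a subdigraph is the product of the weights of its arcs (1 if it has no arcs); the weight of a set of subdigraphs is the sum of their weights (0 for the empty set). A converging tree is a weakly connected weighted digraph in which one vertex (the root) has outdegree zero and all other vertices have outdegree one; a converging forest is a digraph all of whose weakly connected components are converging trees; an in-forest of $\Gamma$ is a spanning subdigraph of $\Gamma$ that is a converging forest. A directed path from $v_0$ to $v_k$ is an alternating sequence $v_0,a_1,v_1,\dots,a_k,v_k$ with all vertices distinct and each $a_i$ an arc from $v_{i-1}$ to $v_i$; the sequence $v_0$ (length $0$) is the path from $v_0$ to $v_0$. $S=(s_{ij})$ satisfies the transition inequality if $s_{ij}s_{jk}\le s_{ik}s_{jj}$ for all $i,j,k$; it satisfies the graph bottleneck identity w.r.t. $\Gamma$ if for all $i,j,k$: $s_{ij}s_{jk}=s_{ik}s_{jj}$ holds if and only if every directed path in $\Gamma$ from $i$ to $k$ contains $j$. $S$ determines a transitional measure for $\Gamma$ if it satisfies both. *)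

(* Defs.v *)
From HB Require Import structures.
From mathcomp Require Import all_boot all_order all_algebra.

Set Implicit Arguments.
Unset Strict Implicit.
Unset Printing Implicit Defensive.

Import Order.TTheory GRing.Theory Num.Theory.
Local Open Scope ring_scope.

(* The vertex set {1, ..., n} is represented by 'I_n. Arcs form a type of
   their own, so that parallel arcs are allowed. *)
Record digraph (R : realFieldType) (n : nat) := Digraph {
  arc : finType;
  src : arc -> 'I_n;
  tgt : arc -> 'I_n;
  weight : arc -> R;
  weight_gt0 : forall a, 0 < weight a;
  loopless : forall a, src a != tgt a }.

Section Digraphs.
Variables (R : realFieldType) (n : nat) (G : digraph R n).

(* A subdigraph is given by a set U of vertices and a set B of arcs whose
   endpoints lie in U; a spanning one (U = [set: 'I_n]) is just a set of arcs. *)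
Implicit Types (U : {set 'I_n}) (B : {set arc G}) (i j k u v r : 'I_n).

Definition subdigraph_weight B : R := \prod_(a in B) weight a.

Definition family_weight (X : {set {set arc G}}) : R :=
  \sum_(B in X) subdigraph_weight B.

Definition outdegree B v : nat := #|[set a in B | src a == v]|.

Definition weakly_adjacent B : rel 'I_n := fun u v =>
  [exists a in B, ((src a == u) && (tgt a == v))
               || ((src a == v) && (tgt a == u))].

Definition weakly_connected U B : bool :=
  [forall u in U, forall v in U, connect (weakly_adjacent B) u v].

Definition converging_tree_rooted U B r : bool :=
  [&& [forall a in B, (src a \in U) && (tgt a \in U)],
      weakly_connected U B,
      r \in U,
      outdegree B r == 0%N &
      [forall v in U :\ r, outdegree B v == 1%N]].

Definition converging_tree U B : bool :=
  [exists r, converging_tree_rooted U B r].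

(* The weakly connected component of v in ([set: 'I_n], B). *)
Definition component_vertices B v : {set 'I_n} :=
  [set u | connect (weakly_adjacent B) v u].

Definition component_arcs B v : {set arc G} :=
  [set a in B | (src a \in component_vertices B v)
             && (tgt a \in component_vertices B v)].

Definition in_forest B : bool :=
  [forall v, converging_tree (component_vertices B v) (component_arcs B v)].

Definition in_tree_rooted_at B i j : bool :=
  converging_tree_rooted (component_vertices B i) (component_arcs B i) j.

Definition in_forest_matrix : 'M[R]_n :=
  \matrix_(i, j) family_weight [set B | in_forest B & in_tree_rooted_at B i j].

(* An alternating sequence v_0, a_1, v_1, ..., a_k, v_k is determined by its
   initial vertex v_0 and its arcs [:: a_1; ...; a_k], since v_m = tgt a_m. *)
Definition path_vertices v (p : seq (arc G)) : seq 'I_n :=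
  v :: [seq tgt a | a <- p].

Fixpoint diwalk v (p : seq (arc G)) : bool :=
  if p is a :: p' then (src a == v) && diwalk (tgt a) p' else true.

Definition directed_path i k (p : seq (arc G)) : bool :=
  [&& diwalk i p, uniq (path_vertices i p) & last i (path_vertices i p) == k].

Definition transition_inequality (S : 'M[R]_n) : Prop :=
  forall i j k, S i j * S j k <= S i k * S j j.

Definition graph_bottleneck_identity (S : 'M[R]_n) : Prop :=
  forall i j k,
    S i j * S j k = S i k * S j j <->
    (forall p : seq (arc G), directed_path i k p -> j \in path_vertices i p).

Definition transitional_measure (S : 'M[R]_n) : Prop :=
  transition_inequality S /\ graph_bottleneck_identity S.

End Digraphs.

(* Main.v *)
From mathcomp Require Import all_boot all_order all_algebra.
From mathcomp Require Import ring.
Require Import Defs.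

(**
In-forests are the arc sets in which every vertex has outdegree at most one and
reaches a sink, the root of its tree. Deleting the arc leaving i, if there is
one, splits the sum over in-forests and yields, for f the total weight of all
in-forests,
  f_ik + \sum_(a : i -> v) w_a (f_ik - f_vk) = [i = k] f,
that is, (I + L) F = f I with L the Laplacian. For fixed j <> k the vector
x_i = f_ik f_jj - f_ij f_jk vanishes at j, and away from j it satisfies
((I + L) x)_i = [i = k] f_jj f. The minimum principle for I + L gives x >= 0
(the transition inequality), and its strong form shows that x_i > 0 exactly
when some path from i to k avoids j (the bottleneck identity).
*)

Set Implicit Arguments.
Unset Strict Implicit.
Unset Printing Implicit Defensive.

Import Order.TTheory GRing.Theory Num.Theory.
Local Open Scope ring_scope.

(** * Properties preserved along connectivity *)

Lemma connect_closed (T : finType) (e : rel T) (P : pred T) x y :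
  (forall u v, e u v -> P u -> P v) -> connect e x y -> P x -> P y.
Proof.
move=> eP /connectP[p + ->]; elim: p x => //= z p IHp x /andP[exz zp] Px.
exact: IHp zp (eP _ _ exz Px).
Qed.

Lemma connect_closedr (T : finType) (e : rel T) (P : pred T) x y :
  (forall u v, e u v -> P v -> P u) -> connect e x y -> P y -> P x.
Proof.
move=> eP /connectP[p + ->]; elim: p x => //= z p IHp x /andP[exz zp] Py.
exact: eP exz (IHp _ zp Py).
Qed.

Lemma connect_head (T : finType) (e : rel T) x y :
  connect e x y -> x != y -> exists2 z, e x z & connect e z y.
Proof.
move=> /connectP[[|z p] /= + ->]; first by rewrite eqxx.
by move=> /andP[exz zp] _; exists z => //; apply/connectP; exists p.
Qed.

Section Forests.
Variables (R : realFieldType) (n : nat) (G : digraph R n).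
Implicit Types (B : {set arc G}) (a b : arc G) (i j k u v r : 'I_n).

(** * Roots in functional arc sets *)

Definition out_adjacent B : rel 'I_n := fun u v =>
  [exists a in B, (src a == u) && (tgt a == v)].

Definition sink B v := [forall a in B, src a != v].

Definition has_root B v r := sink B r && connect (out_adjacent B) v r.

Definition functional B :=
  [forall a in B, forall b in B, (src a == src b) ==> (a == b)].

(** A component-free form of [in_forest]. Cycles are excluded because a vertex on a cycle of a
    functional arc set never reaches a sink. *)
Definition rooted_forest B := functional B && [forall v, exists r, has_root B v r].

Lemma out_adjacentP B u v :
  reflect (exists2 a, a \in B & src a = u /\ tgt a = v) (out_adjacent B u v).
Proof.
apply: (iffP existsP) => [[a /and3P[aB /eqP<- /eqP<-]]|[a aB [<- <-]]].
  by exists a.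
by exists a; rewrite aB !eqxx.
Qed.

Lemma sinkP B v : reflect (forall a, a \in B -> src a != v) (sink B v).
Proof. exact: 'forall_implyP. Qed.

Lemma functionalP B : reflect {in B &, injective (@src R n G)} (functional B).
Proof.
apply: (iffP idP) => [/forall_inP fB a b aB bB ab|injB].
  by have /forall_inP/(_ b bB) := fB a aB; rewrite ab eqxx => /eqP.
apply/forall_inP => a aB; apply/forall_inP => b bB.
by apply/implyP => /eqP/injB -> //.
Qed.

Lemma out_adjacentS B B' : B \subset B' -> subrel (out_adjacent B) (out_adjacent B').
Proof.
move=> /subsetP sB u v /out_adjacentP[a aB av]; apply/out_adjacentP.
by exists a => //; apply: sB.
Qed.

Lemma connect_out_adjacentS B B' : B \subset B' ->
  subrel (connect (out_adjacent B)) (connect (out_adjacent B')).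
Proof.
by move=> sB; apply: connect_sub => u v uv; apply/connect1/(out_adjacentS sB).
Qed.

Lemma sinkS B B' v : B \subset B' -> sink B' v -> sink B v.
Proof. by move=> /subsetP sB /sinkP vB; apply/sinkP => a /sB; apply: vB. Qed.

Lemma connect_sink B u v : sink B u -> connect (out_adjacent B) u v -> u = v.
Proof.
move=> /sinkP uB uv; apply/eqP; apply: contraT => /(connect_head uv)[z].
by case/out_adjacentP=> a /uB + [au]; rewrite au eqxx.
Qed.

(** The first arc of a nontrivial walk from [src a] must be [a] itself, since [B] is functional. *)
Lemma connect_out_step B a v : functional B -> a \in B -> src a != v ->
  connect (out_adjacent B) (src a) v -> connect (out_adjacent B) (tgt a) v.
Proof.
move=> /functionalP injB aB av /connect_head/(_ av)[z /out_adjacentP[b bB [ba <-]]].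
by rewrite (injB _ _ bB aB ba).
Qed.

(** Symmetric in the two ends of an arc, so a root propagates along weak adjacency and is constant
    on weak components. *)
Lemma has_root_src B a r : functional B -> a \in B ->
  has_root B (src a) r = has_root B (tgt a) r.
Proof.
move=> fB aB; apply/andP/andP => -[rB]; last first.
  move=> ar; split=> //; apply: connect_trans ar; apply: connect1.
  by apply/out_adjacentP; exists a.
by move=> ar; split=> //; apply: connect_out_step => //; apply: (sinkP _ _ rB).
Qed.

(** The root [r] is transported along the walk from [v] to [r']; being a sink, [r'] reaches only
    itself. *)
Lemma has_root_inj B v r r' : functional B ->
  has_root B v r -> has_root B v r' -> r = r'.
Proof.
move=> fB vr /andP[r'B vr'].
have /andP[_ /(connect_sink r'B)//] : has_root B r' r.
apply: (connect_closed (P := has_root B ^~ r)) vr' vr => x y.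
by case/out_adjacentP=> a aB [<- <-]; rewrite has_root_src.
Qed.

Lemma has_root_sink B v k : sink B v -> has_root B v k = (v == k).
Proof.
move=> vB; apply/andP/eqP => [[_ /(connect_sink vB)//]|<-].
by split=> //; apply: connect0.
Qed.

(** * Agreement with the definition by weak components *)

Lemma outdegree_eq0 B v : (outdegree B v == 0%N) = sink B v.
Proof.
rewrite /outdegree cards_eq0; apply/eqP/sinkP => [B0 a aB|vB].
  by apply/negP => av; have := in_set0 a; rewrite -B0 inE aB av.
by apply/setP => a; rewrite !inE; apply/negP => /andP[/vB/negP].
Qed.

Lemma outdegree_component B i v : v \in component_vertices B i ->
  outdegree (component_arcs B i) v = outdegree B v.
Proof.
rewrite inE => iv; apply: eq_card => a; rewrite !inE.
case: (boolP (a \in B)) => //= aB; case: eqP => [av|_]; last by rewrite andbF.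
rewrite av iv andbT /=; apply: connect_trans iv (connect1 _).
by apply/existsP; exists a; rewrite aB av !eqxx.
Qed.

Lemma weakly_adjacentP B u v :
  reflect (exists2 a, a \in B & (src a = u /\ tgt a = v) \/ (src a = v /\ tgt a = u))
    (weakly_adjacent B u v).
Proof.
apply: (iffP existsP) => [[a /andP[aB]]|[a aB av]].
  by case/orP=> /andP[/eqP au /eqP av]; exists a; auto.
by exists a; rewrite aB; case: av => -[-> ->]; rewrite !eqxx ?orbT.
Qed.

Lemma weakly_adjacent_sym B : symmetric (weakly_adjacent B).
Proof.
by move=> u v; apply/weakly_adjacentP/weakly_adjacentP => -[a aB av];
  exists a => //; tauto.
Qed.

Lemma weak_connect_sym B : connect_sym (weakly_adjacent B).
Proof. exact/sym_connect_sym/weakly_adjacent_sym. Qed.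

Lemma connect_out_weak B : subrel (connect (out_adjacent B)) (connect (weakly_adjacent B)).
Proof.
apply: connect_sub => u v /out_adjacentP[a aB av]; apply: connect1.
by apply/weakly_adjacentP; exists a; auto.
Qed.

Lemma weakly_connected_component B i :
  weakly_connected (component_vertices B i) (component_arcs B i).
Proof.
have sub v : v \in component_vertices B i ->
    connect (weakly_adjacent (component_arcs B i)) i v.
  (* Membership is carried in the invariant because an arc of [component_arcs] must have both
     endpoints in the component. *)
  rewrite inE => iv; pose P u := (u \in component_vertices B i) &&
    connect (weakly_adjacent (component_arcs B i)) i u.
  suff /andP[] : P v by [].
  apply: (connect_closed _ iv); last by rewrite /P inE !connect0.
  move=> x y xy /andP[ix ix']; rewrite inE in ix.
  have iy := connect_trans ix (connect1 xy).
  rewrite /P inE iy; apply: connect_trans ix' (connect1 _).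
  case/weakly_adjacentP: xy => a aB av; apply/weakly_adjacentP; exists a => //.
  by rewrite !inE aB; case: av => -[-> ->]; rewrite ix iy.
apply/forall_inP => u iu; apply/forall_inP => v iv.
by apply: connect_trans (sub _ iv); rewrite weak_connect_sym sub.
Qed.

(** Every vertex of the component has root [r]. Each one other than [r] thus has a first arc towards
    [r], unique by functionality. *)
Lemma has_root_component B i r : functional B -> has_root B i r ->
  in_tree_rooted_at B i r.
Proof.
move=> fB ir; have /andP[rB cir] := ir.
have Ur : r \in component_vertices B i by rewrite inE connect_out_weak.
have root u : u \in component_vertices B i -> has_root B u r.
  rewrite inE => iu; apply: (connect_closed (P := has_root B ^~ r)) iu ir.
  by move=> x y /weakly_adjacentP[a aB [] [<- <-]]; rewrite has_root_src.
apply/and5P; split=> //.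
- by apply/forall_inP => a; rewrite inE => /andP[].
- exact: weakly_connected_component.
- by rewrite outdegree_component // outdegree_eq0.
- apply/forall_inP => v; rewrite 2!inE => /andP[vr Uv].
  rewrite outdegree_component //; apply/cards1P.
  have /andP[_ /connect_head/(_ vr)[z /out_adjacentP[a aB [av _]]]] := root _ Uv.
  exists a; apply/setP => b; rewrite !inE.
  apply/andP/eqP => [[bB /eqP bv]|->]; last by rewrite aB av.
  by apply: (functionalP _ fB) => //; rewrite av.
Qed.

Lemma component_has_root B i r : functional B -> in_tree_rooted_at B i r ->
  has_root B i r.
Proof.
move=> fB /and5P[_ _ Ur + _].
rewrite outdegree_component // outdegree_eq0 => rB.
rewrite inE weak_connect_sym in Ur.
apply: (connect_closed (P := has_root B ^~ r)) Ur _; last by rewrite has_root_sink.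
by move=> x y /weakly_adjacentP[a aB [] [<- <-]]; rewrite has_root_src.
Qed.

Lemma in_forest_functional B : in_forest B -> functional B.
Proof.
move=> /forallP FB; apply/functionalP => a b aB bB ab.
have /existsP[r /and5P[_ _ _ r0 /forall_inP v1]] := FB (src a).
have Ua : src a \in component_vertices B (src a) by rewrite inE connect0.
have ar : src a != r.
  apply: contraTneq r0 => <-; rewrite outdegree_component // outdegree_eq0.
  by apply/negP => /sinkP/(_ a aB); rewrite eqxx.
have := v1 (src a); rewrite 2!inE ar Ua outdegree_component // => /(_ isT)/cards1P[c Bc].
have /set1P -> : a \in [set c] by rewrite -Bc inE aB eqxx.
by have /set1P -> : b \in [set c] by rewrite -Bc inE bB ab eqxx.
Qed.

Lemma in_forestE B : in_forest B = rooted_forest B.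
Proof.
apply/idP/andP => [FB|[fB /forallP rB]].
  have fB := in_forest_functional FB; split=> //; apply/forallP => v.
  have /existsP[r vr] := forallP FB v.
  by apply/existsP; exists r; apply: component_has_root.
apply/forallP => v; have /existsP[r vr] := rB v.
by apply/existsP; exists r; apply: has_root_component.
Qed.

Lemma in_tree_rooted_atE B i r : rooted_forest B ->
  in_tree_rooted_at B i r = has_root B i r.
Proof.
move=> /andP[fB _]; apply/idP/idP; first exact: component_has_root.
exact: has_root_component.
Qed.

(** * Adding and deleting one arc *)

Lemma has_rootE B v p r : functional B -> has_root B v p ->
  has_root B v r = (p == r).
Proof.
by move=> fB vp; apply/idP/eqP => [|<- //]; apply: has_root_inj vp.
Qed.

Lemma functional_setU1 B a : functional B -> sink B (src a) ->
  functional (a |: B).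
Proof.
move=> /functionalP injB /sinkP aB; apply/functionalP => b c.
rewrite !inE => /predU1P[->|bB] /predU1P[->|cB] //; last exact: injB.
  by move/esym/eqP; rewrite (negPf (aB _ cB)).
by move/eqP; rewrite (negPf (aB _ bB)).
Qed.

(** The tree rooted at [src a] is grafted onto the tree of [tgt a]; all other trees keep their
    roots. The last hypothesis says that these two trees differ, so no cycle is closed. *)
Lemma has_root_setU1 B a v r : rooted_forest B -> sink B (src a) ->
    ~~ has_root B (tgt a) (src a) ->
  has_root (a |: B) v r =
    if has_root B v (src a) then has_root B (tgt a) r else has_root B v r.
Proof.
move=> /andP[fB /forallP rB] aB ta.
have fB1 := functional_setU1 fB aB.
have sB : B \subset a |: B by apply: subsetUr.
have keep u k : k != src a -> has_root B u k -> has_root (a |: B) u k.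
  move=> ka /andP[/sinkP kB uk]; apply/andP; split.
    by apply/sinkP => b /setU1P[->|/kB//]; rewrite eq_sym.
  exact: connect_out_adjacentS sB _ _ uk.
have /existsP[p tp] := rB (tgt a).
have pa : p != src a by apply: contraNneq ta => <-.
have ap : has_root (a |: B) (src a) p by rewrite has_root_src ?setU11 // keep.
have /existsP[q vq] := rB v; case: ifP => [va|/negbT va].
  rewrite (has_rootE _ fB tp); apply: has_rootE => //.
  have [/andP[psink ap'] /andP[_ va']] := (ap, va).
  rewrite /has_root psink; exact: connect_trans (connect_out_adjacentS sB va') ap'.
rewrite (has_rootE _ fB vq); apply: has_rootE => //; apply: (keep _ _ _ vq).
by apply: contraNneq va => <-.
Qed.

Lemma rooted_forest_setU1 B a : rooted_forest B -> sink B (src a) ->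
  ~~ has_root B (tgt a) (src a) -> rooted_forest (a |: B).
Proof.
move=> FB aB ta; have /andP[fB /forallP rB] := FB.
rewrite /rooted_forest functional_setU1 //; apply/forallP => v.
have [va|va] := boolP (has_root B v (src a)).
  have /existsP[p tp] := rB (tgt a).
  by apply/existsP; exists p; rewrite has_root_setU1 // va.
have /existsP[q vq] := rB v.
by apply/existsP; exists q; rewrite has_root_setU1 // (negPf va).
Qed.

Lemma sink_setD1 B a : functional B -> a \in B -> sink (B :\ a) (src a).
Proof.
move=> /functionalP injB aB; apply/sinkP => b /setD1P[ba bB].
by apply: contraNneq ba => /injB-> //.
Qed.

(** A walk to the old root either survives the deletion or leads to [src a], which has become a
    sink. *)
Lemma rooted_forest_setD1 B a : rooted_forest B -> a \in B ->
  rooted_forest (B :\ a).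
Proof.
move=> /andP[fB /forallP rB] aB; have sB : B :\ a \subset B by apply: subD1set.
apply/andP; split.
  apply/functionalP => b c /(subsetP sB) bB /(subsetP sB) cB.
  exact: (functionalP _ fB).
apply/forallP => v; have /existsP[r /andP[rsink vr]] := rB v.
pose P u := connect (out_adjacent (B :\ a)) u (src a) ||
            connect (out_adjacent (B :\ a)) u r.
have /orP[va|vr'] : P v.
- apply: (connect_closedr _ vr); last by rewrite /P connect0 orbT.
  move=> x y /out_adjacentP[b bB [<- <-]].
  have [->|ba] := eqVneq b a; first by rewrite /P connect0.
  have b1 : connect (out_adjacent (B :\ a)) (src b) (tgt b).
    by apply/connect1/out_adjacentP; exists b; rewrite // !inE ba.
  by case/orP=> [|] H; apply/orP; [left|right]; apply: connect_trans H.
- by apply/existsP; exists (src a); rewrite /has_root sink_setD1.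
- by apply/existsP; exists r; rewrite /has_root (sinkS sB).
Qed.

(** Otherwise [a] lies on a cycle, and everything reachable from [src a] leads back to it, including
    its root, which is a sink. *)
Lemma has_root_setD1 B a : rooted_forest B -> a \in B ->
  ~~ has_root (B :\ a) (tgt a) (src a).
Proof.
move=> /andP[fB /forallP rB] aB; apply/negP => /andP[_].
move=> /(connect_out_adjacentS (subD1set _ _)) ta.
have /existsP[r /andP[rsink ar]] := rB (src a).
suff /(connect_sink rsink) ra : connect (out_adjacent B) r (src a).
  by have /eqP := sinkP _ _ rsink a aB; rewrite ra.
apply: (connect_closed (P := connect (out_adjacent B) ^~ (src a))) ar (connect0 _ _).
move=> x y /out_adjacentP[b bB [<- <-]].
have [ba _|ba] := eqVneq (src b) (src a).
  by rewrite ((functionalP _ fB) b a bB aB ba).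
exact: connect_out_step.
Qed.

Lemma rooted_forest0 : rooted_forest set0.
Proof.
apply/andP; split; first by apply/functionalP => a b; rewrite inE.
apply/forallP => v; apply/existsP; exists v; apply/andP; split=> //.
by apply/sinkP => a; rewrite inE.
Qed.

(** * Weighted sums over in-forests *)

Lemma subdigraph_weight_gt0 B : 0 < subdigraph_weight B.
Proof. by apply: prodr_gt0 => a _; apply: weight_gt0. Qed.

Lemma sum_rooted_forest_gt0 (g : {set arc G} -> R) :
    (forall B, 0 <= g B) -> 0 < g set0 ->
  0 < \sum_(B | rooted_forest B) subdigraph_weight B * g B.
Proof.
move=> g_ge0 g0; rewrite (bigD1 set0) ?rooted_forest0 //=.
apply: ltr_wpDr; last by rewrite mulr_gt0 ?subdigraph_weight_gt0.
by apply: sumr_ge0 => B _; rewrite mulr_ge0 // ltW ?subdigraph_weight_gt0.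
Qed.

(** Deleting the arc [a] that leaves [i] is a bijection from the forests where [i] is not a sink to
    the pairs of a forest with sink [i] and an arc from [i] into another tree. *)
Lemma sum_rooted_forest i (g : {set arc G} -> R) :
  \sum_(B | rooted_forest B) subdigraph_weight B * g B =
  \sum_(B | rooted_forest B && sink B i) subdigraph_weight B *
    (g B + \sum_(a | (src a == i) && ~~ has_root B (tgt a) i)
             weight a * g (a |: B)).
Proof.
under [RHS]eq_bigr do rewrite mulrDr.
rewrite (bigID (sink^~ i)) big_split /=; congr (_ + _).
(* Exactly one arc leaves a non-sink [i] and none leaves a sink, so the inner sum selects the
   forests where [i] is not a sink. *)
transitivity (\sum_(B | rooted_forest B)
    \sum_(a | (a \in B) && (src a == i)) subdigraph_weight B * g B).
  rewrite [RHS](bigID (sink^~ i)) /= [X in _ = X + _]big1 ?add0r => [|B].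
    apply: eq_bigr => B /andP[/andP[/functionalP injB _]].
    rewrite negb_forall => /existsP[a]; rewrite negb_imply negbK.
    move=> /andP[aB /eqP ai]; rewrite (big_pred1 a) // => b.
    apply/andP/eqP => [[bB /eqP bi]|->]; last by rewrite aB ai.
    by apply: injB; rewrite // bi.
  move=> /andP[_ /sinkP iB]; rewrite big_pred0 // => a.
  by apply/andP => -[/iB/negP].
under [RHS]eq_bigr do rewrite mulr_sumr.
rewrite (exchange_big_dep (fun a => src a == i)) /=; last by move=> ? ? _ /andP[].
rewrite [RHS](exchange_big_dep (fun a => src a == i)) /=; last first.
  by move=> ? ? _ /andP[].
apply: eq_bigr => a /eqP <-.
rewrite (reindex_onto (fun B => a |: B) (fun B => B :\ a)) /=; last first.
  by move=> B /andP[_ /andP[aB _]]; rewrite setD1K.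
have notin B : sink B (src a) -> a \notin B.
  by move=> /sinkP aB; apply/negP => /aB/eqP.
apply: eq_big => [B|B]; rewrite eqxx setU11 !andbT.
  apply/andP/andP => [[FB /eqP BE]|[/andP[FB aB] ta]]; last first.
    by rewrite rooted_forest_setU1 // setU1K // notin.
  have aB := setU11 a B; rewrite -BE rooted_forest_setD1 //.
  by rewrite sink_setD1 ?has_root_setD1 //; case/andP: FB.
move=> /andP[FB /eqP BE].
have aB : a \notin B by rewrite -BE !inE eqxx.
by rewrite /subdigraph_weight big_setU1 //= mulrCA mulrA.
Qed.

Lemma in_forest_matrixE i k : in_forest_matrix G i k =
  \sum_(B | rooted_forest B) subdigraph_weight B * (has_root B i k)%:R.
Proof.
rewrite mxE /family_weight big_mkcond [RHS]big_mkcond /=.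
apply: eq_bigr => B _; rewrite inE in_forestE.
have [FB|_] := boolP (rooted_forest B) => //=.
by rewrite in_tree_rooted_atE //; case: has_root; rewrite ?mulr1 ?mulr0.
Qed.

(** * The Laplacian equation for the matrix of in-forests *)

Definition total_forest_weight : R :=
  \sum_(B | rooted_forest B) subdigraph_weight B.

(* Row [i] of [I + L] applied to [x], where [L] is the weighted Laplacian. *)
Definition laplacian_shift (x : 'I_n -> R) i : R :=
  x i + \sum_(a : arc G | src a == i) weight a * (x i - x (tgt a)).

(* Fixing a forest [B] with [i] a sink and summing over [B] and the forests
   [b |: B] with [src b = i], the equation already holds for each such [B]:
   [T B] is the contribution to the total weight and [phi B j] the one to the
   entry [(j, k)]. *)
Lemma in_forest_matrix_laplacian i k :
  laplacian_shift (in_forest_matrix G ^~ k) i = (i == k)%:R * total_forest_weight.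
Proof.
rewrite /laplacian_shift.
pose T (B : {set arc G}) : R :=
  1 + \sum_(b : arc G | (src b == i) && ~~ has_root B (tgt b) i) weight b.
pose phi (B : {set arc G}) (j : 'I_n) : R := (has_root B j k)%:R +
  \sum_(b : arc G | (src b == i) && ~~ has_root B (tgt b) i)
     weight b * (has_root (b |: B) j k)%:R.
have FE j : in_forest_matrix G j k =
    \sum_(B | rooted_forest B && sink B i) subdigraph_weight B * phi B j.
  by rewrite in_forest_matrixE (sum_rooted_forest i).
have -> : total_forest_weight =
    \sum_(B | rooted_forest B && sink B i) subdigraph_weight B * T B.
  rewrite /total_forest_weight; under eq_bigr do rewrite -[subdigraph_weight _]mulr1.
  rewrite (sum_rooted_forest i (fun=> 1)); apply: eq_bigr => B _.
  by congr (_ * (_ + _)); apply: eq_bigr => b _; rewrite mulr1.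
rewrite mulr_sumr.
transitivity (\sum_(B | rooted_forest B && sink B i) subdigraph_weight B *
   (phi B i + \sum_(a : arc G | src a == i) weight a * (phi B i - phi B (tgt a)))).
  under [RHS]eq_bigr do rewrite mulrDr mulr_sumr.
  rewrite big_split /= -FE exchange_big /=; congr (_ + _); apply: eq_bigr => a _.
  rewrite !FE -sumrB mulr_sumr; apply: eq_bigr => B _; ring.
apply: eq_bigr => B /andP[FB iB]; rewrite mulrCA; congr (_ * _).
have phi_i : phi B i = (i == k)%:R +
    \sum_(b : arc G | (src b == i) && ~~ has_root B (tgt b) i)
       weight b * (has_root B (tgt b) k)%:R.
  rewrite /phi has_root_sink //; congr (_ + _); apply: eq_bigr => b /andP[/eqP bi bB].
  by rewrite has_root_setU1 ?bi // (has_root_sink _ iB) eqxx.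
(* If [tgt a] has root [i] in [B], it shares the root of [i] in every [b |: B]; otherwise its root
   does not depend on [b]. *)
have phi_tgt a : phi B (tgt a) =
    if has_root B (tgt a) i then phi B i else (has_root B (tgt a) k)%:R * T B.
  case: ifP => ai.
    rewrite phi_i /phi; congr (_ + _).
      by have /andP[fB _] := FB; rewrite (has_rootE _ fB ai).
    apply: eq_bigr => b /andP[/eqP bi bB].
    by rewrite has_root_setU1 ?bi // ai.
  rewrite /phi mulrDr mulr1 mulr_sumr; congr (_ + _).
  apply: eq_bigr => b /andP[/eqP bi bB].
  by rewrite has_root_setU1 ?bi // ai mulrC.
(* Arcs whose target has root [i] contribute zero. The others contribute [(T B - 1) * phi B i - T B
   * (phi B i - (i == k)%:R)], and adding [phi B i] leaves [(i == k)%:R * T B]. *)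
rewrite (bigID (fun a : arc G => has_root B (tgt a) i)) /= big1 ?add0r;
  last by move=> a /andP[_ ai]; rewrite phi_tgt ai subrr mulr0.
rewrite (eq_bigr (fun a : arc G => weight a * phi B i -
     weight a * (has_root B (tgt a) k)%:R * T B));
  last by move=> a /andP[_ /negPf ai]; rewrite phi_tgt ai; ring.
rewrite sumrB -!mulr_suml.
have -> : \sum_(b : arc G | (src b == i) && ~~ has_root B (tgt b) i) weight b = T B - 1.
  by rewrite /T addrC addKr.
have -> : \sum_(b : arc G | (src b == i) && ~~ has_root B (tgt b) i)
    weight b * (has_root B (tgt b) k)%:R = phi B i - (i == k)%:R.
  by rewrite phi_i addrC addKr.
ring.
Qed.

(** * The minimum principle *)

Lemma minimum_principle (C : pred 'I_n) (x : 'I_n -> R) :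
    (forall i, C i -> x i < 0 -> 0 <= laplacian_shift x i) ->
    (forall a, C (src a) -> x (src a) < 0 -> C (tgt a)) ->
  forall i, C i -> 0 <= x i.
Proof.
move=> Lx Cout i0 Ci0; case: (arg_minP x Ci0) => i Ci min_i.
apply: le_trans (min_i _ Ci0); rewrite leNgt; apply/negP => xi.
(* At a negative minimum over [C] every arc term is nonpositive, since its target is again in [C];
   the shift would then be negative. *)
have := Lx i Ci xi; apply/negP; rewrite -ltNge.
apply: ltr_wnDr => //; apply: sumr_le0 => a /eqP ai.
by rewrite pmulr_rle0 ?weight_gt0 // subr_le0 min_i // Cout ?ai.
Qed.

Lemma laplacian_shift_le0 (x : 'I_n -> R) i : (forall v, 0 <= x v) ->
  x i = 0 -> laplacian_shift x i <= 0.
Proof.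
move=> x_ge0 xi; rewrite /laplacian_shift xi add0r; apply: sumr_le0 => a _.
by rewrite pmulr_rle0 ?weight_gt0 // sub0r oppr_le0.
Qed.

Lemma laplacian_shift_lt0 (x : 'I_n -> R) a : (forall v, 0 <= x v) ->
  x (src a) = 0 -> 0 < x (tgt a) -> laplacian_shift x (src a) < 0.
Proof.
move=> x_ge0 xa xt; rewrite /laplacian_shift xa add0r (bigD1 a) //=.
apply: ltr_wnDr; last by rewrite pmulr_rlt0 ?weight_gt0 // sub0r oppr_lt0.
apply: sumr_le0 => b _.
by rewrite pmulr_rle0 ?weight_gt0 // sub0r oppr_le0.
Qed.

Lemma laplacian_shiftN (x : 'I_n -> R) i :
  laplacian_shift (fun v => - x v) i = - laplacian_shift x i.
Proof.
rewrite /laplacian_shift opprD -sumrN; congr (_ + _); apply: eq_bigr => a _; ring.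
Qed.

(** * Paths avoiding a vertex *)

Definition avoiding_step j : rel 'I_n := fun u v =>
  [&& out_adjacent setT u v, u != j & v != j].

Lemma directed_pathP j i k : i != j ->
  reflect (exists2 p, directed_path (G := G) i k p & j \notin path_vertices i p)
    (connect (avoiding_step j) i k).
Proof.
move=> ij; apply: (iffP idP) => [/connectP[q0]|[p /and3P[+ _ /eqP<-]]].
  (* Shortening makes the vertices distinct, as [directed_path] demands; an arc is then chosen for
     each step. *)
  case/shortenP=> q + + _ kE; move: kE => -> {q0}.
  move=> iq uq; suff [p [ip pq jq]] : exists p : seq (arc G),
    [/\ diwalk i p, [seq tgt a | a <- p] = q & j \notin i :: q].
    by exists p; rewrite /directed_path /path_vertices pq // ip uq /= eqxx.
  elim: q i ij iq {uq} => [|v q IHq] i ij /=.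
    by exists [::]; rewrite inE eq_sym.
  move=> /andP[/and3P[/out_adjacentP[a _ [ai av]] _ vj] vq].
  have [p [vp pq jq]] := IHq v vj vq.
  by exists (a :: p); rewrite /= ai eqxx av vp pq inE negb_or eq_sym ij.
rewrite /path_vertices /=; elim: p i ij => [|a p IHp] i ij /=.
  by rewrite connect0.
move=> /andP[/eqP ai ap]; rewrite inE negb_or => /andP[_ jp].
have tj : tgt a != j by move: jp; rewrite inE negb_or eq_sym => /andP[].
apply: connect_trans (IHp _ tj ap jp); apply: connect1.
by rewrite /avoiding_step ij tj !andbT; apply/out_adjacentP; exists a.
Qed.

(** * Sign of the gap in the transition inequality *)

Definition transition_gap (S : 'M[R]_n) j k i : R :=
  S i k * S j j - S i j * S j k.

(** The gap is a combination of columns [k] and [j] with coefficients independent of [i], so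
    linearity applies. *)
Lemma transition_gap_laplacian j k i :
  laplacian_shift (transition_gap (in_forest_matrix G) j k) i =
  ((i == k)%:R * in_forest_matrix G j j - (i == j)%:R * in_forest_matrix G j k)
    * total_forest_weight.
Proof.
rewrite mulrBl ![_ * in_forest_matrix G _ _ * _]mulrAC.
rewrite -!in_forest_matrix_laplacian /laplacian_shift !mulrDl !mulr_suml opprD addrACA -sumrB.
by congr (_ + _); apply: eq_bigr => a _; rewrite /transition_gap; ring.
Qed.

Lemma transition_gap_diag S j k : transition_gap S j k j = 0.
Proof. by rewrite /transition_gap mulrC subrr. Qed.

Lemma total_forest_weight_gt0 : 0 < total_forest_weight.
Proof.
have := @sum_rooted_forest_gt0 (fun=> 1) (fun=> ler01) ltr01.
by under eq_bigr do rewrite mulr1.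
Qed.

Lemma in_forest_matrix_diag_gt0 j : 0 < in_forest_matrix G j j.
Proof.
rewrite in_forest_matrixE; apply: sum_rooted_forest_gt0 => [B|]; first exact: ler0n.
by rewrite has_root_sink ?eqxx //; apply/sinkP => a; rewrite inE.
Qed.

Lemma transition_gap_ge0 j k i : 0 <= transition_gap (in_forest_matrix G) j k i.
Proof.
apply: (@minimum_principle predT) => // v _; have [->|vj] := eqVneq v j.
  by rewrite transition_gap_diag ltxx.
move=> _; rewrite transition_gap_laplacian (negPf vj) mul0r subr0.
by rewrite !mulr_ge0 ?ler0n // ltW ?in_forest_matrix_diag_gt0 ?total_forest_weight_gt0.
Qed.

Lemma transition_gap_gt0 j k i : i != j -> k != j ->
  (0 < transition_gap (in_forest_matrix G) j k i) = connect (avoiding_step j) i k.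
Proof.
set x := transition_gap _ _ _; move=> ij kj.
have x_ge0 : forall v, 0 <= x v by apply: transition_gap_ge0.
have Lx v : v != j ->
    laplacian_shift x v = (v == k)%:R * (in_forest_matrix G j j * total_forest_weight).
  by move=> vj; rewrite transition_gap_laplacian (negPf vj) mul0r subr0 mulrA.
have c_gt0 : 0 < in_forest_matrix G j j * total_forest_weight.
  by rewrite mulr_gt0 ?in_forest_matrix_diag_gt0 ?total_forest_weight_gt0.
apply/idP/idP => [|ik]; last first.
  (* Positivity spreads backwards along arcs: a zero with a positive out-neighbour would have
     negative shift, yet the shift is nonnegative away from [j]. *)
  apply: (connect_closedr (P := fun v => 0 < x v) _ ik) => [u v|].
    case/and3P=> /out_adjacentP[a _ [<- <-]] aj _ xt.
    rewrite lt0r x_ge0 andbT; apply/eqP => xa.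
    have := laplacian_shift_lt0 x_ge0 xa xt.
    by rewrite Lx // ltNge mulr_ge0 ?ler0n // ltW.
  rewrite lt0r x_ge0 andbT; apply/eqP => xk.
  have := laplacian_shift_le0 x_ge0 xk.
  by rewrite Lx // eqxx mul1r leNgt c_gt0.
apply: contraLR => ik; rewrite -leNgt -oppr_ge0.
(* The vertices that cannot reach [k] while avoiding [j], with [j] adjoined because arcs from them
   may lead to [j]. Arcs can leave [C] only from [j], where [x] vanishes, so the minimum principle
   applies to [- x]. *)
pose C v := (v == j) || ~~ connect (avoiding_step j) v k.
apply: (@minimum_principle C (fun v => - x v)); last by rewrite /C ik orbT.
  move=> v Cv; rewrite laplacian_shiftN; case/orP: Cv => [/eqP->|vk].
    by rewrite /x transition_gap_diag oppr0 ltxx.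
  have [->|vj] := eqVneq v j; first by rewrite /x transition_gap_diag oppr0 ltxx.
  rewrite Lx //; have -> : (v == k) = false.
    by apply: contraNF vk => /eqP->.
  by rewrite mul0r oppr0.
move=> a /orP[/eqP->|ak]; first by rewrite /x transition_gap_diag oppr0 ltxx.
have [->|aj] := eqVneq (src a) j; first by rewrite /x transition_gap_diag oppr0 ltxx.
move=> _; rewrite /C; have [//|tj /=] := eqVneq (tgt a) j.
apply: contraNN ak; apply: connect_trans; apply: connect1.
by rewrite /avoiding_step aj tj !andbT; apply/out_adjacentP; exists a; rewrite ?inE.
Qed.

End Forests.

Theorem theorem5 (R : realFieldType) (n : nat) (hn : (1 < n)%N)
    (G : digraph R n) :
  transitional_measure G (in_forest_matrix G).
Proof.
split=> i j k; first by rewrite -subr_ge0; apply: transition_gap_ge0.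
(* If [j] is an endpoint, both sides of the equivalence hold trivially. *)
have [->|ij] := eqVneq i j.
  by split=> _; [move=> p _; rewrite mem_head | rewrite mulrC].
have [->|kj] := eqVneq k j.
  by split=> // _ p /and3P[_ _ /eqP<-] /=; apply: mem_last.
have gapE := transition_gap_gt0 G ij kj; split=> [E p ip|all_j].
  apply: contraT => jp; have /(directed_pathP _ _ ij) : exists2 p : seq (arc G),
    directed_path i k p & j \notin path_vertices i p by exists p.
  by rewrite -gapE /transition_gap E subrr ltxx.
(* Equality means a zero gap; the gap is nonnegative, so it suffices that it is not positive. *)
apply/esym/eqP; rewrite -subr_eq0 eq_le transition_gap_ge0 andbT leNgt gapE.
by apply/negP => /(directed_pathP _ _ ij)[p /all_j ->].
Qed.
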